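(* Let $P\subset\mathbb{R}^D$ be a finite set of points, $k$ a positive integer and $\epsilon>0$. Suppose a procedure $\mathrm{AFN}(P,C,\epsilon')$ returning a $(1+\epsilon')$-approximate furthest neighbor in $P$ to a finite set $C\subset\mathbb{R}^D$ can be implemented in $T(|C|,\epsilon')$ time. Then a $(1+\epsilon)$-approximate Euclidean $k$-center solution for $P$ can be constructed in $O\!\left(D\,T\!\left(k,\tfrac\epsilon3\right)2^{O(k\log k/\epsilon)}\right)$ time.
   Context: $d$ is Euclidean distance, $B(c,r)$ the closed Euclidean ball, and $d(q,C)=\min_{c\in C}d(q,c)$. A point $p\in P$ is a $(1+\epsilon')$-approximate furthest neighbor in $P$ to $C$ if $\max_{p'\in P}d(C,p')\le(1+\epsilon')d(C,p)$. The Euclidean $k$-center problem asks for $C\subset\mathbb{R}^D$ with $|C|\le k$ minimizing $r$ such that $P\subseteq\bigcup_{c\in C}B(c,r)$; $r^*$ is the optimal radius. A $(1+\epsilon)$-approximate solution is a set $C\subset\mathbb{R}^D$ with $|C|\le k$ and a radius $r$ with $P\subseteq\bigcup_{c\in C}B(c,r)$ and $r\le(1+\epsilon)r^*$.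
   Formalization: The exponent O(k log k/ε) is read as O(k log max(2,k)/min(ε,1)): the literal bound fails for k=1 with ε→0, and for very large ε, where writing k centers already exceeds it; for ε>1 the proved bound no longer decreases with ε. *)

(* Defs.v *)
From HB Require Import structures.
From mathcomp Require Import all_boot all_order all_algebra.
From mathcomp Require Import boolp classical_sets reals exp.

Set Implicit Arguments.
Unset Strict Implicit.
Unset Printing Implicit Defensive.

Import Order.TTheory GRing.Theory Num.Theory.
Local Open Scope ring_scope.
Local Open Scope classical_set_scope.

(** * Geometry

    Finite subsets of R^D are given by lists of points. *)

Section Geometry.
Variables (R : realType) (D : nat).
Implicit Types (p q : 'rV[R]_D) (P C : seq 'rV[R]_D) (r e : R) (k : nat).

(* The library norm on 'rV[R]_D is the sup norm, hence this definition. *)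
Definition edist p q : R := Num.sqrt (\sum_(i < D) (p 0 i - q 0 i) ^+ 2).

Definition eball (c : 'rV[R]_D) r : set 'rV[R]_D := [set q | edist q c <= r].

(* The minimum over the points of C, for nonempty C. *)
Definition dset q C : R :=
  \big[Num.min/edist q (head 0 C)]_(c <- C) edist q c.

(* Distances are nonnegative, so 0 is a neutral start for the maximum. *)
Definition approx_furthest P C e p : Prop :=
  p \in P /\ \big[Num.max/0]_(p' <- P) dset p' C <= (1 + e) * dset p C.

Definition covers P C r : Prop :=
  [set` P] `<=` \bigcup_(c in [set` C]) eball c r.

Definition kcenter_opt P k : R :=
  inf [set r | exists C, (size C <= k)%N /\ covers P C r].

Definition approx_kcenter P k e C r : Prop :=
  [/\ (size C <= k)%N, covers P C r & r <= (1 + e) * kcenter_opt P k].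

(* [afn C e] is the answer of the procedure on input (C, e), and [steps C e]
   the time it takes, which is at least one step. *)
Definition implements_AFN P (T : nat -> R -> R)
    (afn : seq 'rV[R]_D -> R -> 'rV[R]_D) (steps : seq 'rV[R]_D -> R -> nat) :=
  forall C e, C != [::] -> 0 < e ->
    [/\ approx_furthest P C e (afn C e), (0 < steps C e)%N
      & (steps C e)%:R <= T (size C) e].

End Geometry.

(** * Model of computation: a real RAM with an AFN subroutine.

    The memory consists of numbered unbounded arrays of natural numbers (used
    as indices and counters) and of numbered unbounded arrays of reals.
    Programs are finite syntactic objects; the only constants are natural
    number literals.  Each arithmetic operation, square root, comparison and
    memory access costs one unit.  There is no conversion from reals to
    naturals (such as a floor). *)

Inductive nexp :=
| NLit of nat
| NGet of nat & nexp
| NAdd of nexp & nexp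
| NSub of nexp & nexp
| NMul of nexp & nexp.

Inductive rexp :=
| RLit of nat
| RGet of nat & nexp
| RAdd of rexp & rexp
| RSub of rexp & rexp
| RMul of rexp & rexp
| RDiv of rexp & rexp
| RSqrt of rexp.

Inductive bexp :=
| BNle of nexp & nexp
| BRle of rexp & rexp
| BNot of bexp
| BAnd of bexp & bexp.

(* [CNSet a i e] and [CRSet a i e] store the value of e at index i of the
   natural, resp. real, array a.  [CCall a m e b i] runs the AFN procedure on
   the first m points of real array a with parameter e, and stores the answer
   as the i-th point of real array b. *)
Inductive cmd :=
| CSkip
| CNSet of nat & nexp & nexp
| CRSet of nat & nexp & rexp
| CSeq of cmd & cmd
| CIf of bexp & cmd & cmd
| CWhile of bexp & cmd
| CCall of nat & nexp & rexp & nat & nexp.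

Record state (R : Type) := State {
  nmem : nat -> nat -> nat;
  rmem : nat -> nat -> R }.

Definition upd (V : Type) (m : nat -> nat -> V) (a i : nat) (v : V) :=
  fun b j => if (b == a) && (j == i) then v else m b j.

Fixpoint ncost (e : nexp) : nat :=
  match e with
  | NLit _ => 1
  | NGet _ e1 => (ncost e1).+1
  | NAdd e1 e2 | NSub e1 e2 | NMul e1 e2 => (ncost e1 + ncost e2).+1
  end.

Fixpoint rcost (e : rexp) : nat :=
  match e with
  | RLit _ => 1
  | RGet _ e1 => (ncost e1).+1
  | RAdd e1 e2 | RSub e1 e2 | RMul e1 e2 | RDiv e1 e2 =>
      (rcost e1 + rcost e2).+1
  | RSqrt e1 => (rcost e1).+1
  end.

Fixpoint bcost (b : bexp) : nat :=
  match b with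
  | BNle e1 e2 => (ncost e1 + ncost e2).+1
  | BRle e1 e2 => (rcost e1 + rcost e2).+1
  | BNot b1 => (bcost b1).+1
  | BAnd b1 b2 => (bcost b1 + bcost b2).+1
  end.

Section Semantics.
Variables (R : realType) (D : nat).
Implicit Type s : state R.

Fixpoint neval s (e : nexp) : nat :=
  match e with
  | NLit n => n
  | NGet a e1 => nmem s a (neval s e1)
  | NAdd e1 e2 => (neval s e1 + neval s e2)%N
  | NSub e1 e2 => (neval s e1 - neval s e2)%N
  | NMul e1 e2 => (neval s e1 * neval s e2)%N
  end.

Fixpoint reval s (e : rexp) : R :=
  match e with
  | RLit n => n%:R
  | RGet a e1 => rmem s a (neval s e1)
  | RAdd e1 e2 => reval s e1 + reval s e2
  | RSub e1 e2 => reval s e1 - reval s e2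
  | RMul e1 e2 => reval s e1 * reval s e2
  | RDiv e1 e2 => reval s e1 / reval s e2
  | RSqrt e1 => Num.sqrt (reval s e1)
  end.

Fixpoint beval s (b : bexp) : bool :=
  match b with
  | BNle e1 e2 => (neval s e1 <= neval s e2)%N
  | BRle e1 e2 => reval s e1 <= reval s e2
  | BNot b1 => ~~ beval s b1
  | BAnd b1 b2 => beval s b1 && beval s b2
  end.

Definition nset s a i v := State (upd (nmem s) a i v) (rmem s).
Definition rset s a i v := State (nmem s) (upd (rmem s) a i v).

(* A real array stores a list of points contiguously: coordinate j of point i
   is at index i * D + j. *)
Definition coord (p : 'rV[R]_D) (j : nat) : R := oapp (p 0) 0 (insub j).

Definition get_point (f : nat -> R) (i : nat) : 'rV[R]_D :=
  \row_(j < D) f (i * D + j)%N.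

Definition get_points (f : nat -> R) (m : nat) : seq 'rV[R]_D :=
  [seq get_point f i | i <- iota 0 m].

Definition set_point s (b i : nat) (p : 'rV[R]_D) : state R :=
  State (nmem s)
    (fun a l => if [&& a == b, i * D <= l & l < i * D + D]%N
                then coord p (l - i * D) else rmem s a l).

Variable afn : seq 'rV[R]_D -> R -> 'rV[R]_D.
Variable steps : seq 'rV[R]_D -> R -> nat.

(* [exec c s t s']: started in state s, command c halts in state s' after time
   t.  A call is charged the running time of the procedure, plus D for
   receiving the coordinates of its answer. *)
Inductive exec : cmd -> state R -> nat -> state R -> Prop :=
| ExecSkip s : exec CSkip s 1 s
| ExecNSet s a i e :
    exec (CNSet a i e) s (ncost i + ncost e).+1
      (nset s a (neval s i) (neval s e))
| ExecRSet s a i e :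
    exec (CRSet a i e) s (ncost i + rcost e).+1
      (rset s a (neval s i) (reval s e))
| ExecSeq c1 c2 s1 s2 s3 t1 t2 :
    exec c1 s1 t1 s2 -> exec c2 s2 t2 s3 ->
    exec (CSeq c1 c2) s1 (t1 + t2) s3
| ExecIf b c1 c2 s t s' :
    exec (if beval s b then c1 else c2) s t s' ->
    exec (CIf b c1 c2) s (bcost b + t) s'
| ExecWhileEnd b c s :
    ~~ beval s b -> exec (CWhile b c) s (bcost b) s
| ExecWhileStep b c s1 s2 s3 t1 t2 :
    beval s1 b -> exec c s1 t1 s2 -> exec (CWhile b c) s2 t2 s3 ->
    exec (CWhile b c) s1 (bcost b + t1 + t2) s3
| ExecCall s a m e b i :
    let C := get_points (rmem s a) (neval s m) in
    exec (CCall a m e b i) s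
      (ncost m + rcost e + ncost i + steps C (reval s e) + D).+1
      (set_point s b (neval s i) (afn C (reval s e))).

(* Input: natural array 0 holds D, k and the length of P; real array 0 holds
   eps; real array 1 holds the points of P.  All other cells are 0. *)
Definition init_state (P : seq 'rV[R]_D) (k : nat) (eps : R) : state R :=
  State
    (fun a i => if a == 0 then nth 0 [:: D; k; size P] i else 0)%N
    (fun a i => if a == 0%N then nth 0 [:: eps] i
                else if a == 1%N then coord (nth 0 P (i %/ D)) (i %% D)
                else 0).

(* Output: the number of centers in cell 0 of natural array 1, the centers in
   real array 2, the radius in cell 0 of real array 3. *)
Definition out_centers s : seq 'rV[R]_D := get_points (rmem s 2) (nmem s 1 0).
Definition out_radius s : R := rmem s 3 0.

(* Executions are deterministic, so it is harmless to assert a property of a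
   run existentially. *)
Lemma exec_det c s t1 s1 t2 s2 :
  exec c s t1 s1 -> exec c s t2 s2 -> t1 = t2 /\ s1 = s2.
Proof.
move=> h; elim: h t2 s2 => {c s t1 s1}.
- by move=> s t2 s2 h; inversion h.
- by move=> s a i e t2 s2 h; inversion h.
- by move=> s a i e t2 s2 h; inversion h.
- move=> c1 c2 s1 s2 s3 t1 t2 _ ih1 _ ih2 t s h; inversion h as
    [| | | ? ? ? s2' ? u1 u2 h1 h2 | | | |]; subst.
  have [-> e2] := ih1 _ _ h1; rewrite -e2 in h2.
  by have [-> ->] := ih2 _ _ h2.
- move=> b c1 c2 s t s' _ ih t2 s2 h; inversion h as
    [| | | | ? ? ? ? u ? h1 | | |]; subst.
  by have [-> ->] := ih _ _ h1.
- move=> b c s nb t2 s2 h; inversion h as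
    [| | | | | | ? ? ? ? ? ? ? hb |]; subst => //.
  by rewrite hb in nb.
- move=> b c s1 s2 s3 t1 t2 hb _ ih1 _ ih2 t s h; inversion h as
    [| | | | | ? ? ? nb | ? ? ? s2' ? u1 u2 _ h1 h2 |]; subst.
    by rewrite hb in nb.
  have [-> e2] := ih1 _ _ h1; rewrite -e2 in h2.
  by have [-> ->] := ih2 _ _ h2.
- by move=> s a m e b i C t2 s2 h; inversion h.
Qed.

End Semantics.

(* Main.v *)
Require Import Defs.
From HB Require Import structures.
From mathcomp Require Import all_boot all_order all_algebra.
From mathcomp Require Import boolp classical_sets reals exp.
From mathcomp Require Import zify ring lra.

Set Implicit Arguments.
Unset Strict Implicit.
Unset Printing Implicit Defensive.

Import Order.TTheory GRing.Theory Num.Theory.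
Local Open Scope ring_scope.

(** A cluster keeps a center [c] and a number [phi] with
    [phi + |c - z|^2 <= r^2] for every ball [B(z, r)] containing the points
    assigned to the cluster so far.  A new point [p] at squared distance [d]
    moves the center to [p + mu (c - p)] with [mu = (d + phi) / (2 d)], the
    choice that maximizes the new value [mu (phi + (1 - mu) d)] of [phi]
    (a Frank-Wolfe step for the dual of the minimum enclosing ball problem).
    If every assigned point is at squared distance at least [X = (1 + e) r^2]
    with [e = min(eps, 1)], the gap [g = X - phi] satisfies
    [g' <= g - g^2 / (4 X)], so that after [n] assignments
    [(n - 1) g <= 4 X]; as [g >= e r^2], a cluster receives fewer than [m]
    points once [m e > 9].

    Repeatedly query the approximate furthest neighbor [p] of the [k] centers
    and guess its cluster in an [r]-cover.  As long as the distance from [p] to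
    the centers, times [1 + eps / 3], exceeds [(1 + eps) r], that distance has
    square at least [X], so with the right guesses this ends within [k m]
    rounds.  The program tries all [k ^ (k m)] guess sequences and keeps the
    best covering radius [(1 + eps / 3) d(p, C)] met on the way; it does not
    need to know [r]. *)

(** * Squared distances, and covers from approximate furthest points *)

Section Distances.
Variables (R : realType) (D : nat).
Implicit Types (p q c z : 'rV[R]_D) (P C : seq 'rV[R]_D).

Definition sqdist p q : R := \sum_(i < D) (p 0 i - q 0 i) ^+ 2.

Lemma edistE p q : edist p q = Num.sqrt (sqdist p q).
Proof. by []. Qed.

Lemma edistC p q : edist p q = edist q p.
Proof. by congr Num.sqrt; apply: eq_bigr => i _; rewrite -sqrrN opprB. Qed.

Lemma sqdist_ge0 p q : 0 <= sqdist p q.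
Proof. by apply: sumr_ge0 => i _; exact: sqr_ge0. Qed.

Lemma edist_ge0 p q : 0 <= edist p q.
Proof. exact: sqrtr_ge0. Qed.

Lemma sqr_edist p q : edist p q ^+ 2 = sqdist p q.
Proof. by rewrite sqr_sqrtr ?sqdist_ge0. Qed.

(** Stewart's identity, valid coordinate by coordinate; it controls how far a moved center is from
    the optimal one. *)
Lemma sqdist_comb p c z (mu : R) :
  sqdist (p + mu *: (c - p)) z =
  mu * sqdist c z + (1 - mu) * sqdist p z - mu * (1 - mu) * sqdist c p.
Proof.
rewrite /sqdist !mulr_sumr -big_split -sumrB /=; apply: eq_bigr => i _.
by rewrite !mxE; ring.
Qed.

Lemma dset_le_edist q C c : c \in C -> dset q C <= edist q c.
Proof. by move=> cC; exact: ge_bigmin_seq. Qed.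

Lemma dset_attained q C : C != [::] -> exists2 c, c \in C & dset q C = edist q c.
Proof.
case: C => [//|c0 C] _; rewrite /dset /=.
(* The start value of the minimum depends on [c0], so the induction keeps it fixed and runs over
   lists contained in [c0 :: C]. *)
suff: forall s : seq 'rV[R]_D, {subset s <= c0 :: C} ->
    exists2 c, c \in c0 :: C & \big[Num.min/edist q c0]_(j <- s) edist q j = edist q c.
  exact.
elim=> [|c s IH] sub.
  by exists c0; rewrite ?mem_head ?big_nil.
have [|x xC xE] := IH; first by move=> y ys; apply: sub; rewrite inE ys orbT.
rewrite big_cons; case: (leP (edist q c) (\big[Num.min/edist q c0]_(j <- s) edist q j)) => _.
  by exists c => //; apply: sub; rewrite mem_head.
by exists x.
Qed.

Lemma approx_furthest_covers P C e p c : 0 <= e -> C != [::] -> c \in C ->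
  approx_furthest P C e p -> covers P C ((1 + e) * edist p c).
Proof.
move=> e0 C0 cC [_ pmax] q /= qP.
have [c' c'C qE] := dset_attained q C0.
exists c' => //; rewrite /eball /= -qE.
apply: le_trans (_ : (1 + e) * dset p C <= _); last first.
  by apply: ler_wpM2l; [lra | exact: dset_le_edist].
apply: le_trans pmax.
elim: P qP => [//|x P IH]; rewrite inE big_cons le_max => /orP[/eqP<-|/IH->].
  by rewrite lexx.
by rewrite orbT.
Qed.

End Distances.

(** * The guessing procedure *)

Section Guessing.
Variables (R : realType) (D : nat).

(* [wgt] is 0 for a cluster to which no point was assigned yet, and 1 otherwise. *)
Record config := Config {
  cen : nat -> 'rV[R]_D;
  phi : nat -> R;
  wgt : nat -> R }.

(* With weight 0, and also at distance 0 where division by zero gives 0, the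
   center jumps to the new point. *)
Definition damping (c : config) (p : 'rV[R]_D) (j : nat) : R :=
  wgt c j * (sqdist (cen c j) p + phi c j) / (2 * sqdist (cen c j) p).

Definition assign (c : config) (p : 'rV[R]_D) (j : nat) : config :=
  let d := sqdist (cen c j) p in
  let mu := damping c p j in
  Config (fun i => if i == j then p + mu *: (cen c j - p) else cen c i)
         (fun i => if i == j then mu * (phi c j + (1 - mu) * d) else phi c i)
         (fun i => if i == j then 1 else wgt c i).

Variables (k : nat) (afn : seq 'rV[R]_D -> 'rV[R]_D).

Definition query (c : config) : 'rV[R]_D := afn [seq cen c i | i <- iota 0 k].

Definition config0 : config := Config (fun=> 0) (fun=> 0) (fun=> 0).

(* The base-k digits of [v], least significant first, are the guessed clusters. *)
Fixpoint branch (v l : nat) : config :=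
  if l is l'.+1 then
    let c := branch v l' in assign c (query c) (v %/ k ^ l' %% k)
  else config0.

(** The first [l'] assignments read only the digits below position [l'], so a guess can be added as
    digit [l] without disturbing the earlier run. *)
Lemma branch_high_digit v j l l' : (0 < k)%N -> (l' <= l)%N ->
  branch (v + j * k ^ l) l' = branch v l'.
Proof.
move=> k0; elim: l' => //= l' IH ll'; rewrite IH ?(ltnW ll') //.
congr (assign _ _ _).
have -> : (k ^ l = k ^ (l - l'.+1) * k * k ^ l')%N.
  by rewrite -expnSr -expnD; congr (_ ^ _)%N; lia.
by rewrite !mulnA [(v + _)%N]addnC divnMDl ?expn_gt0 ?k0 // modnMDl.
Qed.

End Guessing.

(** * The gap recursion for a single cluster *)

Section Progress.
Variable R : realType.

(** Here [n] counts the points assigned before the step; the last conclusion is the gap bound for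
    the count [n + 1]. *)
Lemma potential_step (n X d f mu : R) :
  1 <= n -> 0 < X -> 0 <= f -> f <= X -> X <= d -> (n - 1) * (X - f) <= 4 * X ->
  mu = (d + f) / (2 * d) ->
  [/\ 0 <= mu, mu <= 1, 0 <= mu * (f + (1 - mu) * d)
    & n * (X - mu * (f + (1 - mu) * d)) <= 4 * X].
Proof.
move=> n1 X0 f0 fX Xd nX ->.
have d0 : 0 < d by lra.
have mu0 : 0 <= (d + f) / (2 * d) by rewrite divr_ge0 //; lra.
have mu1 : (d + f) / (2 * d) <= 1 by rewrite ler_pdivrMr; lra.
have -> : (d + f) / (2 * d) * (f + (1 - (d + f) / (2 * d)) * d) =
    (d + f) ^+ 2 / (4 * d) by field; lra.
have f'0 : 0 <= (d + f) ^+ 2 / (4 * d) by rewrite divr_ge0 ?sqr_ge0 //; lra.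
split=> //.
set g := X - f; have g0 : 0 <= g by rewrite /g; lra.
have gX : g <= X by rewrite /g; lra.
(* The new potential [(d + f)^2 / (4 d)] grows with [d] for [d >= f], so the worst case is
   [d = X]. *)
have step : X - (d + f) ^+ 2 / (4 * d) <= g - g ^+ 2 / (4 * X).
  have -> : g - g ^+ 2 / (4 * X) = X - (X + f) ^+ 2 / (4 * X).
    by rewrite /g; field; lra.
  rewrite lerD2l lerN2 ler_pdivrMr; last lra.
  rewrite mulrAC ler_pdivlMr; last lra.
  have -> : (d + f) ^+ 2 * (4 * X) =
      (X + f) ^+ 2 * (4 * d) + 4 * ((d - X) * (d * X - f * f)) by ring.
  rewrite lerDl; apply: mulr_ge0 => //; apply: mulr_ge0; first lra.
  by rewrite subr_ge0; apply: ler_pM; lra.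
apply: le_trans (_ : n * (g - g ^+ 2 / (4 * X)) <= _).
  by apply: ler_wpM2l => //; lra.
(* In terms of [a], the hypothesis reads [n a <= 1 + a] and the claim [n a (1 - a) <= 1], so
   [(1 + a) (1 - a) <= 1] closes it. *)
set a := g / (4 * X).
have gE : g = 4 * X * a by rewrite /a; field; lra.
have a0 : 0 <= a by rewrite /a divr_ge0 //; lra.
have a1 : a <= 1 by rewrite /a ler_pdivrMr; lra.
have na : (n - 1) * a <= 1.
  rewrite -(ler_pM2l (_ : 0 < 4 * X)); last lra.
  by rewrite mulrCA -gE mulr1.
have -> : n * (g - g ^+ 2 / (4 * X)) = 4 * X * (n * a * (1 - a)).
  by rewrite gE; field; lra.
rewrite -[leRHS]mulr1; apply: ler_wpM2l; first lra.
apply: le_trans (_ : (1 + a) * (1 - a) <= 1); last by nra.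
by apply: ler_wpM2r; lra.
Qed.

End Progress.

(** * Pigeonhole along the branch of correct guesses *)

Section Branches.
Variables (R : realType) (D : nat) (k m : nat) (eps r : R).
Variables (P : seq 'rV[R]_D) (afn : seq 'rV[R]_D -> 'rV[R]_D) (z : nat -> 'rV[R]_D).
Hypotheses (k_gt0 : (0 < k)%N) (eps_gt0 : 0 < eps) (r_gt0 : 0 < r).
Hypothesis m_large : 9 < m%:R * Num.min eps 1.
Hypothesis afnP : forall C, C != [::] -> afn C \in P.
Hypothesis z_covers : forall p, p \in P -> exists2 j, (j < k)%N & edist p (z j) <= r.

Let e := Num.min eps 1.
Let X := (1 + e) * r ^+ 2.

Local Notation branch := (branch k afn).
Local Notation query := (query k afn).

Let e_gt0 : 0 < e.
Proof. by rewrite /e lt_min eps_gt0 ltr01. Qed.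

Let e_le1 : e <= 1.
Proof. by rewrite /e ge_min lexx orbT. Qed.

Let e_le : e <= eps.
Proof. by rewrite /e ge_min lexx. Qed.

(* [n j] counts the points assigned to cluster [j], whose optimal center is [z j]. *)
Let tracks (n : nat -> nat) (c : config R D) := forall j, (j < k)%N ->
  (n j = 0%N /\ wgt c j = 0) \/
  [/\ (0 < n j)%N, wgt c j = 1, 0 <= phi c j,
      phi c j + sqdist (cen c j) (z j) <= r ^+ 2
    & ((n j)%:R - 1) * (X - phi c j) <= 4 * X].

(** Since [phi <= r^2], the gap is at least [e r^2], while [4 X <= 8 r^2]. Hence [(n - 1) e <= 8],
    and [e <= 1] gives [n e <= 9]. *)
Let tracks_bound n c j : tracks n c -> (j < k)%N -> (n j < m)%N.
Proof.
move=> tr jk; rewrite -(ltr_nat R) -(ltr_pM2r e_gt0).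
apply: le_lt_trans m_large.
have [[-> _]|[n0 _ f0 fz nX]] := tr j jk; first by rewrite mul0r; lra.
have r2 : 0 < r ^+ 2 by rewrite exprn_gt0.
have n1 : 0 <= (n j)%:R - 1 :> R by rewrite subr_ge0 ler1n.
have ne : ((n j)%:R - 1) * e <= 8.
  rewrite -(ler_pM2r r2) -mulrA.
  apply: le_trans (_ : 4 * X <= _); last by rewrite /X mulrA; apply: ler_wpM2r; [exact: ltW | have := e_le1; lra].
  apply: le_trans nX; apply: ler_wpM2l => //.
  rewrite /X mulrDl mul1r addrAC lerDr subr_ge0.
  by apply: le_trans fz; rewrite lerDl sqdist_ge0.
by move: ne; rewrite mulrBl mul1r; have := e_le1; lra.
Qed.

(** The choice of [eps / 3] matters here: from [e <= eps] and [e eps <= eps] follows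
    [(1 + e / 2) (1 + eps / 3) <= 1 + eps], so [d >= (1 + e / 2) r], whose square is at least
    [X]. *)
Let far_sqdist (d : R) : 0 <= d -> (1 + eps) * r <= (1 + eps / 3) * d -> X <= d ^+ 2.
Proof.
move=> d0 far; have e0 := e_gt0; have e1 := e_le1; have ee := e_le.
have d1 : (1 + e / 2) * r <= d.
  rewrite -(ler_pM2l (_ : 0 < 1 + eps / 3)); last by lra.
  apply: le_trans far; rewrite mulrA; apply: ler_wpM2r; first exact: ltW.
  have : e * eps <= eps by rewrite -[leRHS]mul1r; apply: ler_wpM2r; lra.
  nra.
apply: le_trans (_ : ((1 + e / 2) * r) ^+ 2 <= _).
  rewrite /X exprMn; apply: ler_wpM2r; first exact: sqr_ge0.
  nra.
by rewrite ler_sqr ?nnegrE //; apply: mulr_ge0; [lra | exact: ltW].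
Qed.

Let tracks_assign n c p j : tracks n c -> (j < k)%N ->
  edist p (z j) <= r -> X <= sqdist (cen c j) p ->
  tracks (fun i => (n i + (i == j))%N) (assign c p j).
Proof.
move=> tr jk pz Xd i ik /=; case: eqP => [->|/eqP ij]; last first.
  by rewrite addn0; exact: tr.
right; rewrite addn1.
have pz2 : sqdist p (z j) <= r ^+ 2.
  by rewrite -sqr_edist ler_sqr ?nnegrE ?edist_ge0 // ltW.
have r2 : 0 < r ^+ 2 by rewrite exprn_gt0.
have X0 : 0 < X by apply: mulr_gt0 => //; have := e_gt0; lra.
have rX : r ^+ 2 <= X by rewrite /X; have := e_gt0; nra.
rewrite sqdist_comb.
(* For a first point, weight 0 makes [mu] vanish: the center becomes [p], the potential 0, and the
   gap bound is trivial because its factor [n - 1] is 0. *)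
have [[n0 w0]|[n0 w1 f0 fz nX]] := tr j jk.
  rewrite /damping w0 !mul0r n0 subrr mul0r !subr0 mul1r add0r.
  by split => //; rewrite ?add0r //; lra.
set d := sqdist (cen c j) p in Xd *.
set y := sqdist (cen c j) (z j) in fz *.
have y0 : 0 <= y by exact: sqdist_ge0.
have muE : damping c p j = (d + phi c j) / (2 * d).
  by rewrite /damping w1 mul1r.
have n1 : 1 <= (n j)%:R :> R by rewrite ler1n.
have fX : phi c j <= X by apply: le_trans rX; lra.
have [mu0 mu1 f'0 nX'] := potential_step n1 X0 f0 fX Xd nX muE.
split=> //; last by rewrite -natr1 addrK.
set mu := damping c p j in mu0 mu1 *.
(* The term [mu (1 - mu) d] gained by the potential cancels the one lost in [sqdist_comb], leaving a
   convex combination of two quantities that are at most [r^2]. *)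
have -> : mu * (phi c j + (1 - mu) * d) +
    (mu * y + (1 - mu) * sqdist p (z j) - mu * (1 - mu) * d) =
    mu * (phi c j + y) + (1 - mu) * sqdist p (z j) by ring.
have -> : r ^+ 2 = mu * r ^+ 2 + (1 - mu) * r ^+ 2 by ring.
by apply: lerD; apply: ler_wpM2l => //; rewrite subr_ge0.
Qed.

(** If [rad] exceeded [(1 + eps) r], every query would be far from its centers, so the correct
    guesses could be tracked for [k m] rounds; but [k] clusters with fewer than [m] points each
    cannot hold [k m] points. *)
Lemma some_branch_close (rad : R) :
  (forall v l j, (v < k ^ (k * m))%N -> (l < k * m)%N -> (j < k)%N ->
     rad <= (1 + eps / 3) * edist (cen (branch v l) j) (query (branch v l))) ->
  rad <= (1 + eps) * r.
Proof.
move=> radP; rewrite leNgt; apply/negP => far.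
have [v [n [vk tr ns]]] : exists v n, [/\ (v < k ^ (k * m))%N,
    tracks n (branch v (k * m)) & (\sum_(j < k) n j)%N = (k * m)%N].
  suff: forall l, (l <= k * m)%N -> exists v n, [/\ (v < k ^ l)%N,
    tracks n (branch v l) & (\sum_(j < k) n j)%N = l] by apply.
  elim=> [_|l IH lkm].
    by exists 0%N, (fun=> 0%N); split; rewrite ?big1 // => j _; left.
  have [v [n [vk tr ns]]] := IH (ltnW lkm).
  pose c := branch v l; pose p := query c.
  have pP : p \in P.
    by apply: afnP; rewrite -size_eq0 size_map size_iota -lt0n.
  have [j jk pz] := z_covers pP.
  (* As [v < k ^ l], this writes [j] as digit [l] and keeps the lower digits. *)
  pose v' := (v + j * k ^ l)%N.
  have vlow l' : (l' <= l)%N -> branch v' l' = branch v l'.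
    exact: branch_high_digit.
  have dig : (v' %/ k ^ l %% k)%N = j.
    by rewrite /v' addnC divnMDl ?expn_gt0 ?k_gt0 // divn_small // addn0 modn_small.
  exists v', (fun i => n i + (i == j))%N; split.
  - rewrite /v' expnS; apply: leq_trans (_ : (j.+1 * k ^ l <= _)%N).
      by rewrite mulSn ltn_add2r.
    by rewrite leq_mul2r jk orbT.
  - rewrite /= dig vlow //; apply: tracks_assign => //.
    rewrite -sqr_edist; apply: far_sqdist; first exact: edist_ge0.
    apply: ltW; apply: lt_le_trans far _; apply: radP => //.
    by apply: leq_trans vk _; rewrite leq_pexp2l // ltnW.
  - rewrite big_split /= ns -addn1; congr (_ + _)%N.
    rewrite (bigD1 (Ordinal jk)) //= eqxx big1 // => i /eqP ij.
    by case: eqP => // ij'; case: ij; exact: val_inj.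
have m0 : (0 < m)%N by apply: leq_ltn_trans (tracks_bound tr k_gt0).
have : (\sum_(j < k) n j <= \sum_(j < k) m.-1)%N.
  by apply: leq_sum => j _; rewrite -ltnS prednK // (tracks_bound tr).
by rewrite ns sum_nat_const card_ord leq_pmul2l // -ltnS prednK // ltnn.
Qed.

End Branches.
(** The optimum is an infimum, so it suffices to compare with every feasible radius [r]. Since [r]
    may be 0, the branch argument is applied to [r + h] for arbitrary [h > 0]. *)
Lemma best_radius_le_opt (R : realType) (D k m : nat) (eps rad : R)
    (P Cout : seq 'rV[R]_D) (afn : seq 'rV[R]_D -> 'rV[R]_D) :
  (0 < k)%N -> 0 < eps -> 9 < m%:R * Num.min eps 1 ->
  (forall C, C != [::] -> afn C \in P) ->
  (size Cout <= k)%N -> covers P Cout rad ->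
  (forall v l j, (v < k ^ (k * m))%N -> (l < k * m)%N -> (j < k)%N ->
     rad <= (1 + eps / 3) *
       edist (cen (branch k afn v l) j) (query k afn (branch k afn v l))) ->
  rad <= (1 + eps) * kcenter_opt P k.
Proof.
move=> k0 eps0 mP afnP sC cov radP.
rewrite mulrC -ler_pdivrMr; last lra.
apply: lb_le_inf; first by exists rad, Cout.
move=> r [Cs [sCs covCs]].
(* A point of [P] lies in some ball of each cover, which forces feasible radii to be nonnegative. *)
have pP : afn [:: 0] \in P by exact: afnP.
have r0 : 0 <= r.
  have [c _ cr] := covCs _ pP.
  exact: le_trans (edist_ge0 _ _) cr.
apply/ler_addgt0Pr => h h0.
rewrite ler_pdivrMr; last lra.
rewrite mulrC.
apply: (@some_branch_close R D k m eps (r + h) P afn (nth 0 Cs)) => //.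
  by apply: lt_le_trans h0 _; rewrite lerDr.
move=> p pin; have [c cCs cr] := covCs p pin.
exists (index c Cs); first by apply: leq_trans sCs; rewrite index_mem.
rewrite nth_index //; apply: le_trans cr _.
by rewrite lerDl ltW.
Qed.

(** Taking the least [m] with [10 <= m] and [9 < m eps] lets a counting loop find it without
    rounding a real. The bound [10 <= m] serves [eps > 1], where the minimum is 1; minimality yields
    the upper bound that the running time needs. *)
Lemma rounds_exist (R : realType) (eps : R) : 0 < eps ->
  exists m, [/\ (10 <= m)%N, 9 < m%:R * eps,
    forall x, (10 <= x)%N -> 9 < x%:R * eps -> (m <= x)%N,
    9 < m%:R * Num.min eps 1 & m%:R * Num.min eps 1 <= 10].
Proof.
move=> eps0.
have ex : exists m, (10 <= m)%N && (9 < m%:R * eps).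
  exists (maxn 10 (Num.truncn (9 / eps)).+1); rewrite leq_maxl /=.
  rewrite -ltr_pdivrMr //; apply: lt_le_trans (truncnS_gt _) _.
  by rewrite ler_nat leq_maxr.
case: (ex_minnP ex) => m /andP[m10 m9] minm.
have m10R : 10 <= m%:R :> R by rewrite (ler_nat _ 10).
have pred_le : (10 < m)%N -> m%:R * eps <= 9 + eps.
  case: m m10 m9 minm m10R => // m m10 m9 minm _ lt10.
  rewrite -natr1 mulrDl mul1r lerD2r leNgt; apply/negP => lt9.
  by have := minm m; rewrite lt9 andbT ltnn => /(_ lt10).
exists m; split => //; first by move=> x x10 x9; apply: minm; rewrite x10.
  by rewrite /Num.min; case: ifP => // _; lra.
have [m_le|/pred_le mle] := leqP m 10.
  have -> : m = 10%N by apply/eqP; rewrite eqn_leq m_le.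
  by rewrite -[leRHS]mulr1 ler_wpM2l // ge_min lexx orbT.
have [eps1|eps1] := leP eps 1; first lra.
(* For [eps > 1], [(m - 1) eps <= 9] forces [m - 1 <= 9]. *)
nra.
Qed.

(** * Running times of programs *)

Section Runs.
Variables (R : realType) (D : nat).
Variables (afn : seq 'rV[R]_D -> R -> 'rV[R]_D) (steps : seq 'rV[R]_D -> R -> nat).
Implicit Types (s : state R) (Q : state R -> Prop) (c : cmd).

(** A total-correctness Hoare triple with a time budget; [t] is only an upper bound, so constants
    can be rounded up freely. *)
Definition runs c s (t : nat) Q : Prop :=
  exists t' s', [/\ exec afn steps c s t' s', (t' <= t)%N & Q s'].

Lemma runs_weaken c s t1 t2 Q1 Q2 : runs c s t1 Q1 -> (t1 <= t2)%N ->
  (forall s', Q1 s' -> Q2 s') -> runs c s t2 Q2.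
Proof.
move=> [t [s' [ex le q]]] le' sub.
by exists t, s'; split; [| exact: leq_trans le' | exact: sub].
Qed.

Lemma runs_skip s t Q : Q s -> (0 < t)%N -> runs CSkip s t Q.
Proof. by move=> q t0; exists 1%N, s; split=> //; constructor. Qed.

Lemma runs_nset a i e s t Q : Q (nset s a (neval s i) (neval s e)) ->
  ((ncost i + ncost e).+1 <= t)%N -> runs (CNSet a i e) s t Q.
Proof. by move=> q le; do 2!eexists; split; [constructor | exact: le | exact: q]. Qed.

Lemma runs_rset a i e s t Q : Q (rset s a (neval s i) (reval s e)) ->
  ((ncost i + rcost e).+1 <= t)%N -> runs (CRSet a i e) s t Q.
Proof. by move=> q le; do 2!eexists; split; [constructor | exact: le | exact: q]. Qed.

Lemma runs_seq c1 c2 s t1 t2 t Q1 Q : runs c1 s t1 Q1 ->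
  (forall s1, Q1 s1 -> runs c2 s1 t2 Q) -> (t1 + t2 <= t)%N ->
  runs (CSeq c1 c2) s t Q.
Proof.
move=> [u1 [s1 [e1 l1 q1]]] /(_ _ q1) [u2 [s2 [e2 l2 q2]]] le.
exists (u1 + u2)%N, s2; split => //; first exact: ExecSeq e1 e2.
by apply: leq_trans le; exact: leq_add.
Qed.

Lemma runs_if b c1 c2 s t1 t Q : runs (if beval s b then c1 else c2) s t1 Q ->
  (bcost b + t1 <= t)%N -> runs (CIf b c1 c2) s t Q.
Proof.
move=> [u [s' [e l q]]] le; exists (bcost b + u)%N, s'; split => //.
  exact: ExecIf.
by apply: leq_trans le; rewrite leq_add2l.
Qed.

(* The first argument of [I] is a strictly decreasing variant. *)
Lemma runs_while b c s n u t (I : nat -> state R -> Prop) Q :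
  I n s ->
  (forall i s', I i s' -> beval s' b ->
     runs c s' u (fun s'' => exists2 i', (i' < i)%N & I i' s'')) ->
  (forall i s', I i s' -> ~~ beval s' b -> Q s') ->
  (n * (bcost b + u) + bcost b <= t)%N ->
  runs (CWhile b c) s t Q.
Proof.
move=> I0 body fin; elim/ltn_ind: n s t I0 => n IH s t In le.
have [sb|sb] := boolP (beval s b); last first.
  exists (bcost b), s; split; [exact: ExecWhileEnd | | exact: fin In sb].
  by apply: leq_trans le; rewrite leq_addl.
have [u1 [s1 [e1 l1 [i' i'n Ii']]]] := body n s In sb.
have [u2 [s2 [e2 l2 q]]] := IH i' i'n s1 _ Ii' (leqnn _).
exists (bcost b + u1 + u2)%N, s2; split => //; first exact: ExecWhileStep e1 e2.
apply: leq_trans le; apply: leq_trans (leq_add (leq_add (leqnn _) l1) l2) _.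
by rewrite addnA leq_add2r -mulSn leq_mul2r i'n orbT.
Qed.

Definition nvar (a : nat) : nexp := NGet a (NLit 0).
Definition rvar (a : nat) : rexp := RGet a (NLit 0).
Definition nassign (a : nat) (e : nexp) : cmd := CNSet a (NLit 0) e.
Definition rassign (a : nat) (e : rexp) : cmd := CRSet a (NLit 0) e.

Definition for_loop (x : nat) (e : nexp) (c : cmd) : cmd :=
  CSeq (nassign x (NLit 0))
    (CWhile (BNot (BNle e (nvar x)))
       (CSeq c (nassign x (NAdd (nvar x) (NLit 1))))).

Lemma runs_for x e c s n u t (I : nat -> state R -> Prop) Q :
  I 0%N (nset s x 0 0) ->
  (forall i s', I i s' -> neval s' e = n) ->
  (forall i s', (i < n)%N -> I i s' -> nmem s' x 0 = i ->
     runs c s' u (fun s'' => nmem s'' x 0 = i /\ I i.+1 (nset s'' x 0 i.+1))) ->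
  (forall s', I n s' -> Q s') ->
  (n.+1 * (u + ncost e + 13) <= t)%N ->
  runs (for_loop x e c) s t Q.
Proof.
move=> I0 ne body fin le.
pose J r s' := [/\ (r <= n)%N, nmem s' x 0 = (n - r)%N & I (n - r)%N s'].
apply: (@runs_seq _ _ _ 3 (n * (ncost e + 4 + (u + 6)) + (ncost e + 4))
          _ (fun s' => s' = nset s x 0 0)).
- exact: runs_nset.
- move=> _ ->; apply: (@runs_while _ _ _ n (u + 6) _ J).
  + by rewrite /J subnn; split => //=; rewrite /upd !eqxx.
  + move=> r s' [rn xr Ir] /=; rewrite (ne _ _ Ir) xr -ltnNge => lt.
    have r0 : (0 < r)%N by lia.
    apply: runs_seq (body _ _ lt Ir xr) _ (leqnn _) => s'' [xs Is].
    apply: runs_nset => //=; rewrite xs; exists r.-1; first by lia.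
    have -> : (n - r + 1)%N = (n - r).+1 by lia.
    have nr : (n - r.-1)%N = (n - r).+1 by lia.
    by split; rewrite ?nr //= ?/upd ?eqxx //; lia.
  + move=> r s' [rn xr Ir] /=; rewrite (ne _ _ Ir) xr negbK => lt.
    apply: fin; have <- // : (n - r)%N = n by lia.
  + by have -> : bcost (BNot (BNle e (nvar x))) = (ncost e + 4)%N by rewrite /=; lia.
- apply: leq_trans le; rewrite mulSn.
  have : (n * (ncost e + 4 + (u + 6)) <= n * (u + ncost e + 13))%N.
    by rewrite leq_mul2l; apply/orP; right; lia.
  lia.
Qed.

(** Changes are tracked by whole arrays, so that for concrete lists the side conditions hold by
    computation. *)
Definition frame (ns rs : seq nat) s s' : Prop :=
  (forall a i, a \notin ns -> nmem s' a i = nmem s a i) /\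
  (forall a i, a \notin rs -> rmem s' a i = rmem s a i).

Lemma frame_nset ns rs s s' a i v : a \in ns -> frame ns rs s s' ->
  frame ns rs s (nset s' a i v).
Proof.
move=> an [fn fr]; split=> b j bn; last exact: fr.
rewrite /= /upd; case: eqP => [ba|_]; last exact: fn.
by rewrite ba an in bn.
Qed.

Lemma frame_rset ns rs s s' a i v : a \in rs -> frame ns rs s s' ->
  frame ns rs s (rset s' a i v).
Proof.
move=> ar [fn fr]; split=> b j bn; first exact: fn.
rewrite /= /upd; case: eqP => [ba|_]; last exact: fr.
by rewrite ba ar in bn.
Qed.

Lemma frame_trans s2 ns rs ns1 rs1 ns2 rs2 s1 s3 :
  frame ns1 rs1 s1 s2 -> frame ns2 rs2 s2 s3 ->
  all (mem ns) (ns1 ++ ns2) -> all (mem rs) (rs1 ++ rs2) ->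
  frame ns rs s1 s3.
Proof.
move=> [n1 r1] [n2 r2] /allP subn /allP subr; split=> a i an.
  by rewrite n2 ?n1 //; apply: contra an => an; apply: subn; rewrite mem_cat an ?orbT.
by rewrite r2 ?r1 //; apply: contra an => an; apply: subr; rewrite mem_cat an ?orbT.
Qed.

End Runs.

(** * The program *)

(* Cells 0 of natural arrays (v) and real arrays (a); [aCen] and [aOut] hold
   points, [aPhi], [aWgt] and [aDist] are indexed by clusters. *)
Local Notation vCount := 1%N.
Local Notation vRounds := 2%N.
Local Notation vDepth := 3%N.
Local Notation vTotal := 4%N.
Local Notation vBranch := 5%N.
Local Notation vDigits := 6%N.
Local Notation vStep := 7%N.
Local Notation vCluster := 8%N.
Local Notation vCoord := 9%N.
Local Notation vQuot := 10%N.
Local Notation vIdx := 11%N.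

Local Notation aOut := 2%N.
Local Notation aRad := 3%N.
Local Notation aCen := 4%N.
Local Notation aPhi := 5%N.
Local Notation aWgt := 6%N.
Local Notation aPt := 7%N.
Local Notation aDist := 8%N.
Local Notation aMin := 9%N.
Local Notation aMu := 10%N.
Local Notation aReal := 11%N.

Definition dim_exp : nexp := NGet 0 (NLit 0).
Definition k_exp : nexp := NGet 0 (NLit 1).
Definition eps_exp : rexp := rvar 0.
Definition cluster_get (a : nat) : rexp := RGet a (nvar vCluster).
Definition cell_exp : nexp := NAdd (NMul (nvar vCluster) dim_exp) (nvar vCoord).
Definition diff_exp : rexp := RSub (RGet aCen cell_exp) (RGet aPt (nvar vCoord)).

Definition dist_cmd : cmd :=
  CSeq (CRSet aDist (nvar vCluster) (RLit 0))
    (for_loop vCoord dim_exp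
       (CRSet aDist (nvar vCluster)
          (RAdd (cluster_get aDist) (RMul diff_exp diff_exp)))).

(** Cluster 0 always overwrites the minimum, which discards the value of the previous round. *)
Definition min_cmd : cmd :=
  CIf (BAnd (BNle (NLit 1) (nvar vCluster)) (BRle (rvar aMin) (cluster_get aDist)))
    CSkip (rassign aMin (cluster_get aDist)).

Definition dists_cmd : cmd := for_loop vCluster k_exp (CSeq dist_cmd min_cmd).

Definition radius_exp : rexp :=
  RMul (RAdd (RLit 1) (RDiv eps_exp (RLit 3))) (RSqrt (rvar aMin)).

(** A count of 0 marks that nothing has been recorded yet. *)
Definition record_cmd : cmd :=
  CIf (BAnd (BNle (NLit 1) (nvar vCount)) (BRle (rvar aRad) radius_exp))
    CSkip
    (CSeq (nassign vCount k_exp)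
    (CSeq (rassign aRad radius_exp)
       (for_loop vIdx (NMul k_exp dim_exp)
          (CRSet aOut (nvar vIdx) (RGet aCen (nvar vIdx)))))).

(** Natural expressions have no division; repeated subtraction leaves the remainder in [vDigits]. *)
Definition divide_cmd : cmd :=
  CWhile (BNle k_exp (nvar vDigits))
    (CSeq (nassign vDigits (NSub (nvar vDigits) k_exp))
          (nassign vQuot (NAdd (nvar vQuot) (NLit 1)))).

Definition digit_cmd : cmd :=
  CSeq (nassign vQuot (NLit 0))
  (CSeq divide_cmd
  (CSeq (nassign vCluster (nvar vDigits))
        (nassign vDigits (nvar vQuot)))).

Definition update_cmd : cmd :=
  CSeq (rassign aMu
    (RDiv (RMul (cluster_get aWgt) (RAdd (cluster_get aDist) (cluster_get aPhi)))
          (RMul (RLit 2) (cluster_get aDist))))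
  (CSeq (CRSet aPhi (nvar vCluster)
    (RMul (rvar aMu)
       (RAdd (cluster_get aPhi)
             (RMul (RSub (RLit 1) (rvar aMu)) (cluster_get aDist)))))
  (CSeq (CRSet aWgt (nvar vCluster) (RLit 1))
    (for_loop vCoord dim_exp
       (CRSet aCen cell_exp
          (RAdd (RGet aPt (nvar vCoord)) (RMul (rvar aMu) diff_exp)))))).

(** Recording precedes the update, because the answer certifies a cover by the very centers that
    were queried. *)
Definition step_cmd : cmd :=
  CSeq (CCall aCen k_exp (RDiv eps_exp (RLit 3)) aPt (NLit 0))
  (CSeq dists_cmd (CSeq record_cmd (CSeq digit_cmd update_cmd))).

Definition reset_cmd : cmd :=
  CSeq (nassign vDigits (nvar vBranch))
  (CSeq (for_loop vIdx (NMul k_exp dim_exp) (CRSet aCen (nvar vIdx) (RLit 0)))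
        (for_loop vIdx k_exp
           (CSeq (CRSet aPhi (nvar vIdx) (RLit 0)) (CRSet aWgt (nvar vIdx) (RLit 0))))).

Definition branch_cmd : cmd :=
  CSeq reset_cmd (for_loop vStep (nvar vDepth) step_cmd).

(** [aReal] mirrors [vRounds], since a natural cannot be read as a real in an expression. *)
Definition rounds_cmd : cmd :=
  CSeq (nassign vRounds (NLit 10))
  (CSeq (rassign aReal (RLit 10))
    (CWhile (BRle (RMul (rvar aReal) eps_exp) (RLit 9))
       (CSeq (nassign vRounds (NAdd (nvar vRounds) (NLit 1)))
             (rassign aReal (RAdd (rvar aReal) (RLit 1)))))).

Definition size_cmd : cmd :=
  CSeq (nassign vDepth (NMul k_exp (nvar vRounds)))
  (CSeq (nassign vTotal (NLit 1))
        (for_loop vIdx (nvar vDepth) (nassign vTotal (NMul (nvar vTotal) k_exp)))).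

Definition kcenter_cmd : cmd :=
  CSeq rounds_cmd (CSeq size_cmd (for_loop vBranch (nvar vTotal) branch_cmd)).

(** * Correctness and running time of the program *)

Section Program.
Variables (R : realType) (D k : nat) (eps : R).
Variables (afn : seq 'rV[R]_D -> R -> 'rV[R]_D) (steps : seq 'rV[R]_D -> R -> nat).
Hypotheses (D_gt0 : (0 < D)%N) (k_gt0 : (0 < k)%N) (eps_gt0 : 0 < eps).
Implicit Type s : state R.

Local Notation runs := (runs afn steps).
Local Notation call := (fun C => afn C (eps / 3)).
Local Notation branch := (branch k call).
Local Notation query := (query k call).

Definition input s : Prop :=
  [/\ nmem s 0 0 = D, nmem s 0 1 = k & rmem s 0 0 = eps].

Lemma input_frame ns rs s s' : (0 \notin ns)%N -> (0 \notin rs)%N ->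
  frame ns rs s s' -> input s -> input s'.
Proof.
by move=> n0 r0 [fn fr] [D0 k0 e0]; split; rewrite ?fn ?fr.
Qed.

Definition state_cen s j : 'rV[R]_D := get_point D (rmem s aCen) j.
Definition state_pt s : 'rV[R]_D := get_point D (rmem s aPt) 0.

Lemma dist_runs s j : input s -> nmem s vCluster 0 = j ->
  runs dist_cmd s (D.+1 * 60) (fun s' => [/\ frame [:: vCoord] [:: aDist] s s',
    rmem s' aDist j = sqdist (state_cen s j) (state_pt s)
    & forall i, i != j -> rmem s' aDist i = rmem s aDist i]).
Proof.
move=> inp sj.
pose I i s' := [/\ frame [:: vCoord] [:: aDist] s s',
  rmem s' aDist j = \sum_(0 <= h < i) (rmem s aCen (j * D + h)%N - rmem s aPt h) ^+ 2
  & forall i, i != j -> rmem s' aDist i = rmem s aDist i].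
apply: (@runs_seq _ _ _ _ _ _ _ 4 (D.+1 * 55) _
   (fun s1 => s1 = rset s aDist j 0)); last by lia.
  by apply: runs_rset => //=; rewrite sj.
move=> _ ->; apply: (@runs_for _ _ _ _ _ _ _ _ D 40 _ I) => //.
- split => /=; first by apply: frame_nset => //; exact: frame_rset.
    by rewrite /upd !eqxx big_nil.
  by move=> i ij; rewrite /upd (negPf ij).
- by move=> i s' [fr _ _] /=; rewrite fr.1 //; case: inp.
- move=> i s' iD [fr sE nE] xi; apply: runs_rset => //=.
  have [dE _ _] := inp.
  rewrite xi !fr.1 // sj dE (fr.2 aCen) // (fr.2 aPt) // sE.
  split=> //; split.
  + by apply: frame_nset => //; exact: frame_rset.
  + by rewrite /= /upd !eqxx big_nat_recr.
  + by move=> i' ij; rewrite /= /upd (negPf ij) /= nE.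
- move=> s' [fr sE nE]; split=> //.
  rewrite sE big_mkord /sqdist; apply: eq_bigr => h _.
  by rewrite !mxE mul0n.
Qed.

Lemma dists_runs s : input s ->
  runs dists_cmd s (k.+1 * (D.+1 * 100)) (fun s' =>
    [/\ frame [:: vCluster; vCoord] [:: aDist; aMin] s s',
      forall j, (j < k)%N -> rmem s' aDist j = sqdist (state_cen s j) (state_pt s),
      forall j, (j < k)%N -> rmem s' aMin 0 <= sqdist (state_cen s j) (state_pt s)
    & exists2 j, (j < k)%N & rmem s' aMin 0 = sqdist (state_cen s j) (state_pt s)]).
Proof.
move=> inp; pose d j := sqdist (state_cen s j) (state_pt s).
(* Attainment is claimed only for [0 < i]: before cluster 0 is visited, [aMin] holds a stale
   value. *)
pose I i s' := [/\ frame [:: vCluster; vCoord] [:: aDist; aMin] s s',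
  forall j, (j < i)%N -> rmem s' aDist j = d j,
  forall j, (j < i)%N -> rmem s' aMin 0 <= d j
  & (0 < i)%N -> exists2 j, (j < i)%N & rmem s' aMin 0 = d j].
apply: (@runs_for _ _ _ _ _ _ _ _ k (D.+1 * 60 + 20) _ I).
- by split => //; exact: frame_nset.
- by move=> i s' [fr _ _ _] /=; rewrite fr.1 //; case: inp.
- move=> i s' ik [fr dE minle mineq] xi.
  have inp' : input s' by apply: input_frame fr inp.
  apply: (runs_seq (t2 := 20) (dist_runs inp' xi)); last by [].
  move=> s1 [fr1 d1 dne].
  have x1 : nmem s1 vCluster 0 = i by rewrite fr1.1.
  have {}d1 : rmem s1 aDist i = d i.
    by rewrite d1 /state_cen /state_pt; congr sqdist; apply/rowP => h;
      rewrite !mxE fr.2.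
  have fr' : frame [:: vCluster; vCoord] [:: aDist; aMin] s s1.
    exact: (frame_trans fr fr1).
  have min1 : rmem s1 aMin 0 = rmem s' aMin 0 by rewrite fr1.2.
  have dlt j : (j < i.+1)%N -> rmem s1 aDist j = d j.
    rewrite ltnS leq_eqVlt => /orP[/eqP->//|ji].
    by rewrite dne ?dE // neq_ltn ji.
  apply: (runs_if (t1 := 5)) => //=.
  rewrite x1 min1 d1; case: ifP => [/andP[i0 le]|gt].
    apply: runs_skip => //; split=> //; split => //=.
    - exact: frame_nset.
    - move=> j; rewrite min1 ltnS leq_eqVlt => /orP[/eqP->//|]; exact: minle.
    - move=> _; have [j ji jE] := mineq i0.
      by exists j; rewrite ?min1 // ltnS ltnW.
  apply: runs_rset => //=; rewrite x1 d1; split => //; split => //=.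
  - by apply: frame_nset => //; exact: frame_rset.
  - move=> j ji; rewrite /upd /= ltnS leq_eqVlt in ji *.
    move: ji => /orP[/eqP->//|ji].
    have i0 : (0 < i)%N by apply: leq_ltn_trans ji.
    move: gt; rewrite i0 /= => /negbT; rewrite -ltNge => /ltW gt.
    exact: le_trans gt (minle j ji).
  - by move=> _; exists i; rewrite ?ltnS.
- by move=> s' [fr dE minle /(_ k_gt0) mineq]; split.
- by rewrite leq_mul2l; apply/orP; right; rewrite /=; lia.
Qed.

Lemma cell_lt i h : (i < k)%N -> (h < D)%N -> (i * D + h < k * D)%N.
Proof.
move=> ik hD; apply: leq_trans (_ : (i.+1 * D <= _)%N).
  by rewrite mulSn addnC ltn_add2r.
by rewrite leq_mul2r ik orbT.
Qed.

Lemma eq_get_points (f g : nat -> R) :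
  (forall i, (i < k * D)%N -> f i = g i) -> get_points D f k = get_points D g k.
Proof.
move=> fg; apply/eq_in_map => i; rewrite mem_iota add0n => /andP[_ ik].
by apply/rowP => h; rewrite !mxE fg // cell_lt.
Qed.

Section Steps.
Variable P : seq 'rV[R]_D.

Definition output_ok s : Prop := nmem s vCount 0 = 0 \/
  (nmem s vCount 0 = k /\ covers P (out_centers D s) (out_radius s)).

(** The last two clauses drive the search: the radius drops to at most the new candidate and never
    rises, so bounds by earlier candidates persist. *)
Lemma record_runs s : input s -> output_ok s ->
  let r := (1 + eps / 3) * Num.sqrt (rmem s aMin 0) in
  covers P (get_points D (rmem s aCen) k) r ->
  runs record_cmd s ((k * D).+1 * 100) (fun s' =>
    [/\ frame [:: vCount; vIdx] [:: aOut; aRad] s s', nmem s' vCount 0 = k,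
      covers P (out_centers D s') (out_radius s'), out_radius s' <= r
    & nmem s vCount 0 = k -> out_radius s' <= out_radius s]).
Proof.
move=> inp ok r cov; have [DE kE eE] := inp.
apply: (runs_if (t1 := (k * D).+1 * 70)); last by rewrite /=; lia.
rewrite /= eE -/r; case: ifP => [/andP[c0 le]|gt].
  apply: runs_skip; last by lia.
  by case: ok => [c0'|[cE covout]]; [rewrite c0' in c0 | split].
have radle : nmem s vCount 0 = k -> r <= out_radius s.
  by move=> cE; move: gt; rewrite cE k_gt0 /= => /negbT; rewrite -ltNge => /ltW.
apply: (runs_seq (t1 := 10) (t2 := (k * D).+1 * 50)
  (Q1 := fun s1 => s1 = nset s vCount 0 k)); last by lia.
  by apply: runs_nset => //=; rewrite kE.
move=> _ ->.
apply: (runs_seq (t1 := 15) (t2 := (k * D).+1 * 30)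
  (Q1 := fun s1 => s1 = rset (nset s vCount 0 k) aRad 0 r)); last by lia.
  by apply: runs_rset => //=; rewrite eE.
move=> _ ->.
pose I i s' := [/\ frame [:: vCount; vIdx] [:: aOut; aRad] s s',
  nmem s' vCount 0 = k, out_radius s' = r
  & forall i', (i' < i)%N -> rmem s' aOut i' = rmem s aCen i'].
apply: (@runs_for _ _ _ _ _ _ _ _ (k * D) 6 _ I).
- by split => //; apply: frame_nset => //; apply: frame_rset => //; apply: frame_nset.
- by move=> i s' [fr _ _ _] /=; rewrite !fr.1 // kE DE.
- move=> i s' ikD [fr cE rE oE] xi; apply: runs_rset => //=.
  rewrite xi fr.2 //; split => //; split => //.
  + by apply: frame_nset => //; exact: frame_rset.
  + move=> i'; rewrite /= /upd /= ltnS leq_eqVlt => /orP[/eqP->|lt].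
      by rewrite eqxx.
    by rewrite ltn_eqF // oE.
- move=> s' [fr cE rE oE]; split; rewrite ?rE //.
  by rewrite /out_centers cE (eq_get_points (g := rmem s aCen)).
- by rewrite /=; lia.
Qed.

Lemma digit_runs s v : input s -> nmem s vDigits 0 = v ->
  runs digit_cmd s (v.+1 * 60) (fun s' =>
    [/\ frame [:: vDigits; vCluster; vQuot] [::] s s',
      nmem s' vCluster 0 = (v %% k)%N & nmem s' vDigits 0 = (v %/ k)%N]).
Proof.
move=> inp vE; have [DE kE eE] := inp.
apply: (runs_seq (t1 := 10) (t2 := v.+1 * 50)
  (Q1 := fun s1 => s1 = nset s vQuot 0 0)); last by lia.
  by apply: runs_nset.
move=> _ ->.
pose J r s' := [/\ frame [:: vDigits; vCluster; vQuot] [::] s s',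
  nmem s' vDigits 0 = r & v = (nmem s' vQuot 0 * k + r)%N].
apply: (runs_seq (t1 := v.+1 * 30) (t2 := 20)
  (Q1 := fun s' => exists2 r, J r s' & (r < k)%N)); last by lia.
  apply: (@runs_while _ _ _ _ _ _ _ v 20 _ J).
  - by split => //; apply: frame_nset.
  - move=> r s' [fr rE vr] /=; rewrite fr.1 // kE rE => kr.
    apply: (runs_seq (t1 := 10) (t2 := 10)
      (Q1 := fun s1 => s1 = nset s' vDigits 0 (r - k))) => //.
      by apply: runs_nset => //=; rewrite (fr.1 0%N) // kE rE.
    move=> _ ->; apply: runs_nset => //=.
    exists (r - k)%N; first by lia.
    split => //; first by do 2!apply: frame_nset => //.
    by rewrite /= /upd /= mulnDl mul1n; lia.
  - move=> r s' [fr rE vr] /=; rewrite fr.1 // kE rE -ltnNge => rk.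
    by exists r.
  - by rewrite /=; lia.
move=> s' [r [fr rE vr] rk].
apply: (runs_seq (t1 := 10) (t2 := 10)
  (Q1 := fun s1 => s1 = nset s' vCluster 0 r)) => //.
  by apply: runs_nset => //=; rewrite rE.
move=> _ ->; apply: runs_nset => //=; split.
- by do 2!apply: frame_nset => //.
- by rewrite /= /upd /= vr modnMDl modn_small.
- by rewrite /= /upd /= vr divnMDl // divn_small // addn0.
Qed.

Definition repr s (c : config R D) : Prop := forall j, (j < k)%N ->
  [/\ state_cen s j = cen c j, rmem s aPhi j = phi c j & rmem s aWgt j = wgt c j].

Lemma cell_inj i j g h : (g < D)%N -> (h < D)%N ->
  (i * D + g == j * D + h)%N = (i == j) && (g == h).
Proof.
move=> gD hD; apply/eqP/andP => [E|[/eqP-> /eqP->]//].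
have := congr1 (modn^~ D) E; have := congr1 (divn^~ D) E.
rewrite /= !modnMDl !divnMDl // !modn_small // !divn_small // !addn0.
by move=> -> ->.
Qed.

Lemma update_runs s c p j : input s -> nmem s vCluster 0 = j -> (j < k)%N ->
  repr s c -> state_pt s = p -> rmem s aDist j = sqdist (cen c j) p ->
  runs update_cmd s (D.+1 * 120) (fun s' =>
    frame [:: vCoord] [:: aMu; aPhi; aWgt; aCen] s s' /\ repr s' (assign c p j)).
Proof.
move=> inp jE jk rep pE dE; have [DE kE eE] := inp.
have [cj fj wj] := rep j jk.
pose mu := damping c p j.
pose s1 := rset s aMu 0 mu.
pose s2 := rset s1 aPhi j (mu * (phi c j + (1 - mu) * sqdist (cen c j) p)).
pose s3 := rset s2 aWgt j 1.
apply: (runs_seq (t1 := 20) (t2 := D.+1 * 100) (Q1 := eq s1)); last by lia.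
  by apply: runs_rset => //=; rewrite jE wj dE fj.
move=> _ <-.
apply: (runs_seq (t1 := 20) (t2 := D.+1 * 80) (Q1 := eq s2)); last by lia.
  by apply: runs_rset => //=; rewrite jE /upd /= fj dE.
move=> _ <-.
apply: (runs_seq (t1 := 20) (t2 := D.+1 * 60) (Q1 := eq s3)); last by lia.
  by apply: runs_rset => //=; rewrite jE.
move=> _ <-.
have fr3 : frame [:: vCoord] [:: aMu; aPhi; aWgt; aCen] s s3.
  by do 3!apply: frame_rset => //.
(* Coordinates from [i] on still hold the old center, so updating in place reads unmodified data. *)
pose I i s' := frame [:: vCoord] [:: aCen] s3 s' /\
  forall j' h, (h < D)%N -> rmem s' aCen (j' * D + h) =
    if (j' == j) && (h < i)%N then rmem s aPt h + mu * (rmem s aCen (j * D + h) - rmem s aPt h)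
    else rmem s aCen (j' * D + h).
apply: (@runs_for _ _ _ _ _ _ _ _ D 40 _ I).
- by split=> [|j' h _]; [exact: frame_nset | rewrite andbF].
- by move=> i s' [fr _] /=; rewrite fr.1.
- move=> i s' iD [fr sE] xi; apply: runs_rset => //=.
  rewrite xi !fr.1 //= jE DE (fr.2 aPt) //= (fr.2 aMu) //= sE // ltnn andbF.
  split=> //; split.
    by apply: frame_nset => //; exact: frame_rset.
  move=> j' h hD; rewrite /= /upd /= cell_inj // sE //.
  have -> : (h < i.+1)%N = (h == i) || (h < i)%N by rewrite ltnS leq_eqVlt.
  have [->|_] := eqVneq j' j; last by [].
  by have [->|_] := eqVneq h i.
- move=> s' [fr sE]; split; first exact: (frame_trans fr3 fr).
  move=> i ik /=; have [ci fi wi] := rep i ik.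
  rewrite !fr.2 //= /upd /= fi wi; split => //; first last.
  apply/rowP => h; rewrite !mxE sE // (ltn_ord h) andbT -ci.
  case: (i == j); last by rewrite mxE.
  have ph : p 0 h = rmem s aPt h by rewrite -pE mxE.
  by rewrite -cj !mxE ph.
- by rewrite /=; lia.
Qed.

Variable B : nat.
Hypothesis afnP : forall C, C != [::] -> approx_furthest P C (eps / 3) (afn C (eps / 3)).
Hypothesis stepsP : forall C, size C = k -> (steps C (eps / 3) <= B)%N.

(** [W] collects the pairs of branch number and depth already queried. The bound by every center
    amounts to the bound by the nearest one. *)
Definition recorded s (W : nat -> nat -> Prop) : Prop :=
  output_ok s /\ forall v l, W v l -> nmem s vCount 0 = k /\
    forall j, (j < k)%N -> out_radius s <=
      (1 + eps / 3) * edist (cen (branch v l) j) (query (branch v l)).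

Lemma recorded_frame ns rs s s' W : vCount \notin ns -> aOut \notin rs ->
  aRad \notin rs -> frame ns rs s s' -> recorded s W -> recorded s' W.
Proof.
move=> nc no nr [fn fr] [ok rec].
have cE : nmem s' vCount 0 = nmem s vCount 0 by rewrite fn.
have rE : out_radius s' = out_radius s by rewrite /out_radius fr.
have oE : out_centers D s' = out_centers D s.
  by rewrite /out_centers cE /get_points; apply/eq_in_map => i _; apply/rowP => h;
    rewrite !mxE fr.
by rewrite /recorded /output_ok cE rE oE.
Qed.

Lemma repr_frame ns rs s s' c : aCen \notin rs -> aPhi \notin rs -> aWgt \notin rs ->
  frame ns rs s s' -> repr s c -> repr s' c.
Proof.
move=> n4 n5 n6 [fn fr] rep j jk; have [cj fj wj] := rep j jk.
rewrite !fr //; split=> //; rewrite -cj.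
by apply/rowP => h; rewrite !mxE fr.
Qed.

Lemma repr_points s c : repr s c ->
  get_points D (rmem s aCen) k = [seq cen c i | i <- iota 0 k].
Proof.
move=> rep; apply/eq_in_map => i; rewrite mem_iota add0n => /andP[_ ik].
by have [] := rep i ik.
Qed.

Lemma call_runs s c : input s -> repr s c ->
  runs (CCall aCen k_exp (RDiv eps_exp (RLit 3)) aPt (NLit 0)) s (B + D + 20) (fun s' =>
    frame [::] [:: aPt] s s' /\ state_pt s' = query c).
Proof.
move=> [DE kE eE] rep.
do 2!eexists; split; first exact: ExecCall.
  rewrite /= kE eE (repr_points rep).
  set x := steps _ _; have : (x <= B)%N; last by lia.
  by apply: stepsP; rewrite size_map size_iota.
rewrite /= kE eE (repr_points rep); split.
  split=> // a i /=; rewrite inE => /negPf an.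
  by rewrite /set_point /= an.
apply/rowP => h; rewrite mxE /set_point /= mul0n add0n add0n ltn_ord subn0.
by rewrite /Defs.coord valK.
Qed.

Let Ns := [:: vCount; vDigits; vCluster; vCoord; vQuot; vIdx].
Let Rs := [:: aOut; aRad; aCen; aPhi; aWgt; aPt; aDist; aMin; aMu].

(** [B] pays for the call and [M], which bounds [v], for the repeated subtractions; distances,
    recording and update take time of order [k D]. *)
Lemma step_runs s v l M (W : nat -> nat -> Prop) : input s -> (v < M)%N ->
  repr s (branch v l) -> nmem s vDigits 0 = (v %/ k ^ l)%N -> recorded s W ->
  runs step_cmd s (1000 * (k * D * (B + M))) (fun s' =>
    [/\ frame Ns Rs s s', repr s' (branch v l.+1),
      nmem s' vDigits 0 = (v %/ k ^ l.+1)%N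
    & recorded s' (fun v' l' => W v' l' \/ (v' = v /\ l' = l))]).
Proof.
move=> inp vM rep dig rec.
set c := branch v l in rep *; set p := query c.
have e3 : 0 <= eps / 3 by rewrite divr_ge0 // ltW.
have kD0 : (0 < k * D)%N by rewrite muln_gt0 k_gt0.
have kkD : (k <= k * D)%N by rewrite leq_pmulr.
have DkD : (D <= k * D)%N by rewrite leq_pmull.
have M0 : (0 < M)%N by apply: leq_ltn_trans vM.
have nM : (k * D <= k * D * M)%N by rewrite leq_pmulr.
have MnM : (M <= k * D * M)%N by rewrite leq_pmull.
have BnB : (B <= k * D * B)%N by rewrite leq_pmull.
have vle : (v %/ k ^ l <= v)%N by apply: leq_div.
set u := (v %/ k ^ l)%N in dig vle *.
apply: (runs_seq (t2 := k.+1 * (D.+1 * 100) + (k * D).+1 * 100 + u.+1 * 60 + D.+1 * 120)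
  (call_runs inp rep)); last first.
  have -> : (k.+1 * (D.+1 * 100) = 100 * (k * D) + 100 * k + 100 * D + 100)%N by ring.
  rewrite !mulnDr; lia.
move=> s1 [fr1 p1].
have inp1 : input s1 by apply: input_frame fr1 inp.
have rep1 : repr s1 c by apply: repr_frame fr1 rep.
apply: (runs_seq (t2 := (k * D).+1 * 100 + u.+1 * 60 + D.+1 * 120)
  (dists_runs inp1)); last by rewrite !addnA.
move=> s2 [fr2 dist2 minle mineq].
have fr02 := frame_trans fr1 fr2; rewrite /= in fr02.
have inp2 : input s2 by apply: input_frame fr2 inp1.
have rep2 : repr s2 c by apply: repr_frame fr2 rep1.
have d2 j : (j < k)%N -> rmem s2 aDist j = sqdist (cen c j) p.
  by move=> jk; rewrite dist2 // p1; have [-> _ _] := rep1 j jk.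
have mle j : (j < k)%N -> Num.sqrt (rmem s2 aMin 0) <= edist (cen c j) p.
  move=> jk; rewrite edistE ler_wsqrtr //.
  by have := minle j jk; rewrite p1; have [-> _ _] := rep1 j jk.
have [j0 j0k meq] : exists2 j, (j < k)%N & Num.sqrt (rmem s2 aMin 0) = edist (cen c j) p.
  have [j jk mj] := mineq; exists j => //.
  by rewrite mj edistE p1; have [-> _ _] := rep1 j jk.
have rec2 : recorded s2 W.
  by apply: recorded_frame fr2 _ => //; apply: recorded_frame fr1 rec.
have cov : covers P (get_points D (rmem s2 aCen) k)
    ((1 + eps / 3) * Num.sqrt (rmem s2 aMin 0)).
  rewrite meq edistC (repr_points rep2).
  have C0 : [seq cen c i | i <- iota 0 k] != [::].
    by rewrite -size_eq0 size_map size_iota -lt0n.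
  apply: (approx_furthest_covers e3 C0 _ (afnP C0)).
  by apply: map_f; rewrite mem_iota.
apply: (runs_seq (t2 := u.+1 * 60 + D.+1 * 120)
  (record_runs inp2 rec2.1 cov)); last by rewrite !addnA.
move=> s3 [fr3 cnt3 cov3 radle radmono].
have inp3 : input s3 by apply: input_frame fr3 inp2.
have rep3 : repr s3 c by apply: repr_frame fr3 rep2.
have d3 j : (j < k)%N -> rmem s3 aDist j = sqdist (cen c j) p.
  by move=> jk; rewrite fr3.2 // d2.
have dig3 : nmem s3 vDigits 0 = u by rewrite fr3.1 // fr2.1 // fr1.1.
have p3 : state_pt s3 = p.
  by rewrite -[p]p1; apply/rowP => h; rewrite !mxE fr3.2 // fr2.2.
(* The new pair is bounded by the candidate just compared, older pairs by monotonicity of the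
   radius. *)
have rec3 : recorded s3 (fun v' l' => W v' l' \/ (v' = v /\ l' = l)).
  split; first by right.
  move=> v' l' [Wvl|[-> ->]]; split=> // j jk; last first.
    apply: le_trans radle _; apply: ler_wpM2l; [exact: addr_ge0 | exact: mle].
  have [cnt2 /(_ j jk)] := rec2.2 v' l' Wvl.
  exact: le_trans (radmono cnt2).
apply: (runs_seq (t2 := D.+1 * 120) (digit_runs inp3 dig3)); last by [].
move=> s4 [fr4 j4 dig4].
have jk : (u %% k < k)%N by rewrite ltn_mod.
have inp4 : input s4 by apply: input_frame fr4 inp3.
have rep4 : repr s4 c by apply: repr_frame fr4 rep3.
have p4 : state_pt s4 = p.
  by rewrite -p3; apply/rowP => h; rewrite !mxE fr4.2.
have d4 : rmem s4 aDist (u %% k) = sqdist (cen c (u %% k)) p by rewrite fr4.2 // d3.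
apply: (runs_weaken (update_runs inp4 j4 jk rep4 p4 d4)) => // s5 [fr5 rep5].
split=> //.
- have f1 : frame Ns Rs s s2 by exact: (frame_trans fr1 fr2).
  have f2 : frame Ns Rs s s3 by exact: (frame_trans f1 fr3).
  have f3 : frame Ns Rs s s4 by exact: (frame_trans f2 fr4).
  exact: (frame_trans f3 fr5).
- by rewrite fr5.1 // dig4 /u -divnMA -expnSr.
- by apply: recorded_frame fr5 _ => //; apply: recorded_frame fr4 rec3.
Qed.

Lemma reset_runs s v : input s -> nmem s vBranch 0 = v ->
  runs reset_cmd s ((k * D).+1 * 100) (fun s' =>
    [/\ frame [:: vDigits; vIdx] [:: aCen; aPhi; aWgt] s s', repr s' (config0 R D)
      & nmem s' vDigits 0 = v]).
Proof.
move=> inp vE; have [DE kE eE] := inp.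
have kkD : (k <= k * D)%N by rewrite leq_pmulr.
apply: (runs_seq (t1 := 10) (t2 := (k * D).+1 * 90)
  (Q1 := eq (nset s vDigits 0 v))); last by lia.
  by apply: runs_nset => //=; rewrite vE.
move=> _ <-.
pose I i s' := [/\ frame [:: vDigits; vIdx] [:: aCen; aPhi; aWgt] s s',
  forall i', (i' < i)%N -> rmem s' aCen i' = 0 & nmem s' vDigits 0 = v].
apply: (runs_seq (t1 := (k * D).+1 * 40) (t2 := k.+1 * 50) (Q1 := I (k * D)%N)); last by lia.
  apply: (@runs_for _ _ _ _ _ _ _ _ (k * D) 6 _ I) => //.
  - by split => //; do 2!apply: frame_nset => //.
  - by move=> i s' [fr _ _] /=; rewrite !fr.1 // DE kE.
  - move=> i s' ikD [fr zE dE] xi; apply: runs_rset => //=.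
    rewrite xi; split=> //; split => //.
      by apply: frame_nset => //; exact: frame_rset.
    move=> i'; rewrite /= /upd /= ltnS leq_eqVlt.
    by have [->|ii /= lt] := eqVneq i' i; last exact: zE.
  - by rewrite /=; lia.
move=> s1 [fr1 z1 d1].
pose J i s' := [/\ frame [:: vIdx] [:: aPhi; aWgt] s1 s',
  forall i', (i' < i)%N -> rmem s' aPhi i' = 0 & forall i', (i' < i)%N -> rmem s' aWgt i' = 0].
apply: (@runs_for _ _ _ _ _ _ _ _ k 20 _ J).
- by split => //; apply: frame_nset.
- by move=> i s' [fr _ _] /=; rewrite fr.1 // fr1.1.
- move=> i s' ik [fr fE wE] xi.
  apply: (runs_seq (t1 := 10) (t2 := 10) (Q1 := eq (rset s' aPhi i 0))) => //.
    by apply: runs_rset => //=; rewrite xi.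
  move=> _ <-; apply: runs_rset => //=; rewrite xi; split=> //; split.
  + by apply: frame_nset => //; do 2!apply: frame_rset => //.
  + move=> i'; rewrite /= /upd /= ltnS leq_eqVlt.
    by have [->|ii /= lt] := eqVneq i' i; last exact: fE.
  + move=> i'; rewrite /= /upd /= ltnS leq_eqVlt.
    by have [->|ii /= lt] := eqVneq i' i; last exact: wE.
- move=> s' [fr fE wE]; split.
  + exact: (frame_trans fr1 fr).
  + move=> j jk /=; rewrite fE ?wE //; split=> //; apply/rowP => h.
    by rewrite !mxE fr.2 // z1 // cell_lt.
  + by rewrite fr.1.
- by rewrite /=; lia.
Qed.

Lemma branch_runs s v L M (W : nat -> nat -> Prop) : input s -> (v < M)%N ->
  nmem s vBranch 0 = v -> nmem s vDepth 0 = L -> recorded s W ->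
  runs branch_cmd s (L.+1 * (1300 * (k * D * (B + M)))) (fun s' =>
    frame (vStep :: Ns) Rs s s' /\
    recorded s' (fun v' l' => W v' l' \/ (v' = v /\ (l' < L)%N))).
Proof.
move=> inp vM vE LE rec.
have kD0 : (0 < k * D)%N by rewrite muln_gt0 k_gt0.
have M0 : (0 < M)%N by apply: leq_ltn_trans vM.
have nM : (k * D <= k * D * (B + M))%N by rewrite leq_pmulr // addn_gt0 M0 orbT.
set S := (k * D * (B + M))%N in nM *.
apply: (runs_seq (t2 := L.+1 * (1000 * S + 20)) (reset_runs inp vE)); last first.
  have -> : (L.+1 * (1300 * S) = 1300 * (L.+1 * S))%N by ring.
  have -> : (L.+1 * (1000 * S + 20) = 1000 * (L.+1 * S) + 20 * L.+1)%N by ring.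
  have : (S <= L.+1 * S)%N by rewrite leq_pmull.
  have : (L.+1 <= L.+1 * S)%N by rewrite leq_pmulr // (leq_trans kD0).
  move: (L.+1 * S)%N => X; lia.
move=> s1 [fr1 rep1 dig1].
have inp1 : input s1 by apply: input_frame fr1 inp.
have rec1 : recorded s1 W by apply: recorded_frame fr1 rec.
pose I l s' := [/\ frame (vStep :: Ns) Rs s s', repr s' (branch v l),
  nmem s' vDigits 0 = (v %/ k ^ l)%N
  & recorded s' (fun v' l' => W v' l' \/ (v' = v /\ (l' < l)%N))].
apply: (@runs_for _ _ _ _ _ _ _ _ L (1000 * S) _ I).
- have frn : frame [:: vStep] [::] s1 (nset s1 vStep 0 0) by exact: frame_nset.
  split => //; first exact: (frame_trans fr1 frn).
  + by rewrite frn.1 // dig1 divn1.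
  + apply: recorded_frame frn _ => //; split; first exact: rec1.1.
    by move=> v' l' [|[]] //; exact: rec1.2.
- by move=> i s' [fr _ _ _] /=; rewrite fr.1.
- move=> l s' lL [fr rep dig rc] xl.
  have inp' : input s' by apply: input_frame fr inp.
  apply: (runs_weaken (step_runs inp' vM rep dig rc)) => // s2 [fr2 rep2 dig2 rc2].
  split; first by rewrite fr2.1.
  have frn : frame [:: vStep] [::] s2 (nset s2 vStep 0 l.+1) by exact: frame_nset.
  have fr' : frame (vStep :: Ns) Rs s s2 by exact: (frame_trans fr fr2).
  split.
  + exact: (frame_trans fr' frn).
  + exact: rep2.
  + exact: dig2.
  + apply: recorded_frame frn _ => //; split; first exact: rc2.1.
    move=> v' l' H; apply: rc2.2; case: H => [|[->]]; first by left; left.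
    by rewrite ltnS leq_eqVlt => /orP[/eqP->|lt]; [right | left; right].
- by move=> s' [fr _ _ rc].
- by rewrite /= leq_mul2l; apply/orP; right; lia.
Qed.

Lemma rounds_runs s m : input s -> (10 <= m)%N -> 9 < m%:R * eps ->
  (forall x, (10 <= x)%N -> 9 < x%:R * eps -> (m <= x)%N) ->
  runs rounds_cmd s (m * 100) (fun s' =>
      frame [:: vRounds] [:: aReal] s s' /\ nmem s' vRounds 0 = m).
Proof.
move=> inp m10 m9 minm; have [DE kE eE] := inp.
apply: (runs_seq (t1 := 10) (t2 := m * 90) (Q1 := eq (nset s vRounds 0 10))); last by lia.
  exact: runs_nset.
move=> _ <-.
apply: (runs_seq (t1 := 10) (t2 := m * 80)
  (Q1 := eq (rset (nset s vRounds 0 10) aReal 0 10))); last by lia.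
  exact: runs_rset.
move=> _ <-.
pose J r s' := exists x, [/\ frame [:: vRounds] [:: aReal] s s',
  nmem s' vRounds 0 = x /\ rmem s' aReal 0 = x%:R, (10 <= x)%N & (x + r)%N = m].
apply: (@runs_while _ _ _ _ _ _ _ (m - 10) 30 _ J).
- exists 10%N; split => //; last by lia.
  by apply: frame_rset => //; apply: frame_nset.
- move=> r s' [x [fr [nx rx] x10 xr]] /=; rewrite rx fr.2 // eE => x9.
  (* The loop test holds at [x] but fails at [m], so the variant is still positive. *)
  have xm : x <> m by move=> xm; rewrite xm leNgt m9 in x9.
  apply: (runs_seq (t1 := 10) (t2 := 10) (Q1 := eq (nset s' vRounds 0 x.+1))) => //.
    by apply: runs_nset => //=; rewrite nx addn1.
  move=> _ <-; apply: runs_rset => //=.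
  exists r.-1; first by lia.
  exists x.+1; split; [| | by lia | by lia].
    by apply: frame_rset => //; apply: frame_nset.
  by rewrite /= /upd /= rx natr1.
- move=> r s' [x [fr [nx rx] x10 xr]] /=; rewrite rx fr.2 // eE -ltNge => x9.
  (* On exit [x] is admissible, so minimality gives [m <= x]. *)
  by split=> //; rewrite nx; have := minm x x10 x9; lia.
- by rewrite /=; lia.
Qed.

Lemma size_runs s m : input s -> nmem s vRounds 0 = m ->
  runs size_cmd s ((k * m).+1 * 100) (fun s' =>
    [/\ frame [:: vDepth; vTotal; vIdx] [::] s s', nmem s' vDepth 0 = (k * m)%N
      & nmem s' vTotal 0 = (k ^ (k * m))%N]).
Proof.
move=> inp mE; have [DE kE eE] := inp.
apply: (runs_seq (t1 := 10) (t2 := (k * m).+1 * 90)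
  (Q1 := eq (nset s vDepth 0 (k * m)))); last by lia.
  by apply: runs_nset => //=; rewrite kE mE.
move=> _ <-.
apply: (runs_seq (t1 := 10) (t2 := (k * m).+1 * 80)
  (Q1 := eq (nset (nset s vDepth 0 (k * m)) vTotal 0 1))); last by lia.
  exact: runs_nset.
move=> _ <-.
pose I i s' := [/\ frame [:: vDepth; vTotal; vIdx] [::] s s',
  nmem s' vDepth 0 = (k * m)%N & nmem s' vTotal 0 = (k ^ i)%N].
apply: (@runs_for _ _ _ _ _ _ _ _ (k * m) 10 _ I).
- by split => //; do 3!apply: frame_nset => //.
- by move=> i s' [fr dE tE] /=.
- move=> i s' ikm [fr dE tE] xi; apply: runs_nset => //=.
  rewrite tE fr.1 // kE; split=> //; split => //.
    by do 2!apply: frame_nset => //.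
  by rewrite /= /upd /= expnSr.
- by [].
- by rewrite /=; lia.
Qed.

(** The main term is [M] branches of [L] rounds at cost [k D (B + M)]. As [B] and [M] are positive,
    [B + M <= 2 B M], whence the factor [M ^ 2]; every other summand is at most a constant times the
    main term. *)
Lemma total_cost m L M : (0 < B)%N -> (0 < L)%N -> (0 < M)%N -> (m <= L)%N ->
  (m * 100 + (L.+1 * 100 + M.+1 * (L.+1 * (1300 * (k * D * (B + M))) + 20)) <=
   200 * 100 * (D * B * (k * L * M ^ 2)))%N.
Proof.
move=> B0 L0 M0 mL; set S := (k * D * (B + M))%N.
have S0 : (0 < S)%N by rewrite !muln_gt0 k_gt0 D_gt0 addn_gt0 B0.
set X := (M * (L * S))%N.
have Xle : (X <= 2 * (D * B * (k * L * M ^ 2)))%N.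
  have BM : (B + M <= 2 * (B * M))%N.
    have : (B <= B * M)%N by rewrite leq_pmulr.
    have : (M <= B * M)%N by rewrite leq_pmull.
    lia.
  have -> : X = (M * L * (k * D) * (B + M))%N by rewrite /X /S; ring.
  have -> : (2 * (D * B * (k * L * M ^ 2)) = M * L * (k * D) * (2 * (B * M)))%N by ring.
  by rewrite leq_mul2l BM orbT.
have LS : (L <= L * S)%N by rewrite leq_pmulr.
have SL : (S <= L * S)%N by rewrite leq_pmull.
have SX : (L * S <= X)%N by rewrite leq_pmull.
have MX : (M <= X)%N by rewrite leq_pmulr // (leq_trans L0 LS).
have MSX : (M * S <= X)%N by rewrite leq_mul2l SL orbT.
have -> : (L.+1 * (1300 * S) = 1300 * (L * S + S))%N by ring.
have -> : (M.+1 * (1300 * (L * S + S) + 20) =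
   1300 * X + 1300 * (M * S) + 20 * M + 1300 * (L * S) + 1300 * S + 20)%N.
  by rewrite /X; ring.
move: (D * B * _)%N (L * S)%N (M * S)%N Xle LS SL SX MX MSX => Y U V.
by clearbody X S; lia.
Qed.

Lemma kcenter_runs s m : input s -> nmem s vCount 0 = 0%N -> (0 < B)%N ->
  (10 <= m)%N -> 9 < m%:R * eps ->
  (forall x, (10 <= x)%N -> 9 < x%:R * eps -> (m <= x)%N) ->
  runs kcenter_cmd s (200 * 100 * (D * B * (k * (k * m) * (k ^ (k * m)) ^ 2))) (fun s' =>
    [/\ nmem s' vCount 0 = k, covers P (out_centers D s') (out_radius s')
      & forall v l j, (v < k ^ (k * m))%N -> (l < k * m)%N -> (j < k)%N ->
        out_radius s' <=
          (1 + eps / 3) * edist (cen (branch v l) j) (query (branch v l))]).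
Proof.
move=> inp cnt0 B0 m10 m9 minm.
set M := (k ^ (k * m))%N; set L := (k * m)%N.
have L0 : (0 < L)%N by rewrite muln_gt0 k_gt0; lia.
have M0 : (0 < M)%N by rewrite expn_gt0 k_gt0.
have mL : (m <= L)%N by rewrite leq_pmull.
set S := (k * D * (B + M))%N.
have S0 : (0 < S)%N by rewrite !muln_gt0 k_gt0 D_gt0 addn_gt0 B0.
set X := (M * (L * S))%N.
apply: (runs_seq (t2 := L.+1 * 100 + M.+1 * (L.+1 * (1300 * S) + 20))
  (rounds_runs inp m10 m9 minm)); last exact: total_cost.
move=> s1 [fr1 m1].
have inp1 : input s1 by apply: input_frame fr1 inp.
apply: (runs_seq (size_runs inp1 m1) _ (leqnn _)) => s2 [fr2 L2 M2].
have inp2 : input s2 by apply: input_frame fr2 inp1.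
pose I i s' := [/\ input s', nmem s' vDepth 0 = L, nmem s' vTotal 0 = M
  & recorded s' (fun v l => (v < i)%N /\ (l < L)%N)].
apply: (@runs_for _ _ _ _ _ _ _ _ M (L.+1 * (1300 * S)) _ I).
- have frn : frame [:: vBranch] [::] s2 (nset s2 vBranch 0 0) by exact: frame_nset.
  split => //; split; last by move=> v l [].
  by left; rewrite frn.1 // fr2.1 // fr1.1.
- by move=> i s' [_ _ ME _].
- move=> v s' vM [inp' LE ME rc] xv.
  apply: (runs_weaken (branch_runs inp' vM xv LE rc)) => // s3 [fr3 rc3].
  split; first by rewrite fr3.1.
  have frn : frame [:: vBranch] [::] s3 (nset s3 vBranch 0 v.+1) by exact: frame_nset.
  have inp3 : input s3 by apply: input_frame fr3 inp'.
  split.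
  + by apply: input_frame frn inp3.
  + by rewrite frn.1 // fr3.1.
  + by rewrite frn.1 // fr3.1.
  + apply: recorded_frame frn _ => //; split; first exact: rc3.1.
    move=> v' l' [v'v l'L]; apply: rc3.2; move: v'v.
    by rewrite ltnS leq_eqVlt => /orP[/eqP->|lt]; [right | left].
- move=> s' [inp' LE ME [ok rc]].
  (* Branch 0 was visited at depth 0, so some cover has been recorded. *)
  have [cnt _] := rc 0%N 0%N (conj M0 L0).
  split=> //; last by move=> v l j vM lL; have [_] := rc v l (conj vM lL); apply.
  by case: ok => [c0|[]//]; move: k_gt0; rewrite -cnt c0.
- by rewrite /= leq_mul2l; apply/orP; right; lia.
Qed.

End Steps.

End Program.

(** * The step count as a power of 2, and the conclusion *)

Lemma cost_le_powR (R : realType) (k m : nat) (e : R) :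
  (0 < k)%N -> (0 < m)%N -> 0 < e -> m%:R * e <= 10 ->
  (k * (k * m) * (k ^ (k * m)) ^ 2)%:R <=
    2 `^ (50 / ln 2 * (k%:R * ln (maxn 2 k)%:R / e)) :> R.
Proof.
move=> k0 m0 e0 me; set q := maxn 2 k.
have kq : (k <= q)%N by rewrite leq_maxr.
have q2 : (2 <= q)%N by rewrite leq_maxl.
have lnq : 0 <= ln q%:R :> R by rewrite ln_ge0 // ler1n ltnW.
have ln2 : 0 < ln 2 :> R by rewrite ln_gt0 // ltr1n.
apply: le_trans (_ : (q ^ (5 * (k * m)))%:R <= _).
  (* Every factor is bounded by a power of [q], using [m <= 2 ^ m <= q ^ m]; the exponents add up to
     [2 + m + 2 k m <= 5 k m]. *)
  rewrite ler_nat; apply: leq_trans (_ : (q * (q * q ^ m) * (q ^ (k * m)) ^ 2 <= _)%N).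
    apply: leq_mul; last by rewrite leq_exp2r // leq_exp2r // muln_gt0 k0.
    apply: leq_mul => //; apply: leq_mul => //.
    apply: leq_trans (_ : (2 ^ m <= _)%N); first exact: ltnW (ltn_expl _ _).
    by rewrite leq_exp2r.
  rewrite -expnS -expnS -expnM -expnD leq_pexp2l //; first exact: ltnW.
  have : (1 <= k * m)%N by rewrite muln_gt0 k0.
  have : (m <= k * m)%N by rewrite leq_pmull.
  lia.
have q0 : 0 < q%:R :> R by rewrite ltr0n ltnW.
rewrite natrX -[q%:R in leLHS]lnK ?posrE // -expRM_natl /powR.
rewrite pnatr_eq0 /= ler_expR.
(* The 50 is 5 times the bound 10 on [m e]; dividing by [ln 2] changes the base from that of [exp]
   to 2. *)
have -> : 50 / ln 2 * (k%:R * ln q%:R / e) * ln 2 = 50 * k%:R * ln q%:R / e :> R.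
  by field; rewrite !gt_eqF.
rewrite ler_pdivlMr // !natrM.
have -> : 5%:R * (k%:R * m%:R) * ln q%:R * e = 5 * (k%:R * ln q%:R) * (m%:R * e) :> R by ring.
have -> : 50 * k%:R * ln q%:R = 5 * (k%:R * ln q%:R) * 10 :> R by ring.
by apply: ler_wpM2l => //; rewrite !mulr_ge0.
Qed.

Theorem theorem7 (R : realType) :
  exists (algo : cmd) (A c : R),
  forall (D : nat) (P : seq 'rV[R]_D) (k : nat) (eps : R)
         (T : nat -> R -> R)
         (afn : seq 'rV[R]_D -> R -> 'rV[R]_D)
         (steps : seq 'rV[R]_D -> R -> nat),
    (0 < D)%N -> (0 < k)%N -> 0 < eps ->
    implements_AFN P T afn steps ->
    exists (t : nat) (s : state R),
      [/\ exec afn steps algo (init_state P k eps) t s,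
          approx_kcenter P k eps (out_centers D s) (out_radius s)
        & t%:R <= A * (D%:R * T k (eps / 3)
            * 2 `^ (c * (k%:R * ln (maxn 2 k)%:R / Num.min eps 1)))].
Proof.
exists kcenter_cmd, (200 * 100)%:R, (50 / ln 2) => D P k eps T afn steps D0 k0 eps0 afnT.
have e30 : 0 < eps / 3 by rewrite divr_gt0.
have afnP C : C != [::] -> approx_furthest P C (eps / 3) (afn C (eps / 3)).
  by move=> C0; have [] := afnT C (eps / 3) C0 e30.
have nonnil (C : seq 'rV[R]_D) : size C = k -> C != [::].
  by case: C => // kE; rewrite -kE in k0.
have Tge C : size C = k -> (steps C (eps / 3))%:R <= T k (eps / 3).
  by move=> sC; have [_ _] := afnT C (eps / 3) (nonnil C sC) e30; rewrite sC.
(* A call takes at least one step, and [k] copies of the origin are an admissible input. *)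
have T1 : 1 <= T k (eps / 3).
  have sC : size (nseq k (0 : 'rV[R]_D)) = k by rewrite size_nseq.
  apply: le_trans (Tge _ sC); rewrite ler1n.
  by have [] := afnT _ (eps / 3) (nonnil _ sC) e30.
have T0 : 0 <= T k (eps / 3) by apply: le_trans T1.
(* Step counts are naturals, so they remain bounded after truncation. *)
pose B := Num.truncn (T k (eps / 3)).
have stepsP C : size C = k -> (steps C (eps / 3) <= B)%N.
  by move=> sC; rewrite truncn_ge_nat // Tge.
have B0 : (0 < B)%N by rewrite truncn_gt0.
have BT : B%:R <= T k (eps / 3) by rewrite truncn_le.
have [m [m10 m9 minm me9 me10]] := rounds_exist eps0.
have inp : input D k eps (init_state P k eps) by split.
have [t [s [ex tle [cnt cov radP]]]] :=
  kcenter_runs D0 k0 eps0 afnP stepsP inp erefl B0 m10 m9 minm.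
have sC : size (out_centers D s) = k by rewrite size_map size_iota.
exists t, s; split=> //.
  split=> //; first by rewrite sC.
  apply: (best_radius_le_opt k0 eps0 me9 _ _ cov radP); last by rewrite sC.
  by move=> C /afnP[].
apply: le_trans (_ : (200 * 100 * (D * B * (k * (k * m) * (k ^ (k * m)) ^ 2)))%:R <= _).
  by rewrite ler_nat.
rewrite natrM ler_wpM2l // natrM natrM.
apply: ler_pM => //; first by rewrite mulr_ge0.
  by rewrite ler_wpM2l.
apply: cost_le_powR => //; first by apply: leq_trans m10.
by rewrite lt_min eps0 ltr01.
Qed.
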